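(* Let $t_0\in\mathbb{R}$ and let $b,k:[t_0,\infty)\to\mathbb{R}$ be continuous functions. Suppose that $$\int_{t_0}^\infty e^{-\int_{t_0}^s b(\sigma)\,d\sigma}\,ds<\infty,$$ $$e^{-\int_{t_0}^s b(\sigma)\,d\sigma}<2\quad\text{for all } s\ge t_0,$$ $$\int_{t_0}^\infty e^{-\int_{t_0}^s b(\sigma)\,d\sigma}\int_{t_0}^s |k(\tau)|\,e^{\int_{t_0}^\tau b(\sigma)\,d\sigma}\,d\tau\,ds<\frac12,$$ $$e^{-\int_{t_0}^s b(\sigma)\,d\sigma}\int_{t_0}^s |k(\tau)|\,e^{\int_{t_0}^\tau b(\sigma)\,d\sigma}\,d\tau<\frac12\quad\text{for all } s\ge t_0.$$ Then the zero solution of $u''(t)+b(t)u'(t)+k(t)u(t)=0$ on $[t_0,\infty)$ is stable.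
   Context: The zero solution of the second-order equation is called stable if for each $\epsilon>0$ there exists $\delta=\delta(\epsilon,t_0)>0$ such that every solution $u$ on $[t_0,\infty)$ with $u(t_0)^2+u'(t_0)^2<\delta^2$ satisfies $u(t)^2+u'(t)^2<\epsilon^2$ for all $t\ge t_0$. The initial time $t_0$ is fixed. *)

(* Defs.v *)
From Stdlib Require Import Reals.
From Coquelicot Require Import Coquelicot.
Open Scope R_scope.

(** Functions on the half-line [t0, +oo) are represented by total functions
    [R -> R] whose values on (-oo, t0) are never used. *)
Definition half_line (t0 : R) : R -> Prop := fun t => t0 <= t.

(** [g] is the derivative of [f] on the domain [D]: the limit of the difference
    quotients is taken along points of [D] only, so that it is the right-hand
    derivative at the left endpoint of a half-line (where Coquelicot's
    [is_derive] would involve values of [f] outside [D]). *)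
Definition derivative_on (D : R -> Prop) (f g : R -> R) : Prop :=
  forall t, D t ->
    filterlim (fun s => (f s - f t) / (s - t))
      (within (fun s => D s /\ s <> t) (locally t)) (locally (g t)).

(** [u], with first derivative [du], solves u'' + b u' + k u = 0 on
    [t0, +oo). *)
Definition solution (t0 : R) (b k u du : R -> R) : Prop :=
  derivative_on (half_line t0) u du /\
  exists ddu : R -> R,
    derivative_on (half_line t0) du ddu /\
    forall t, t0 <= t -> ddu t + b t * du t + k t * u t = 0.

Definition zero_solution_stable (t0 : R) (b k : R -> R) : Prop :=
  forall eps : R, 0 < eps ->
  exists delta : R, 0 < delta /\
  forall u du : R -> R, solution t0 b k u du ->
    u t0 ^ 2 + du t0 ^ 2 < delta ^ 2 ->
    forall t, t0 <= t -> u t ^ 2 + du t ^ 2 < eps ^ 2.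

(** Convergence of the improper integral is a separate conjunct because
    [RInt_gen] has an unspecified value when the integral diverges. *)
Definition improper_integral_lt (f : R -> R) (t0 c : R) : Prop :=
  ex_RInt_gen f (at_point t0) (Rbar_locally p_infty) /\
  RInt_gen f (at_point t0) (Rbar_locally p_infty) < c.

(* Main.v *)
Require Import Defs.
From Stdlib Require Import Reals Lra.
From Coquelicot Require Import Coquelicot.
Open Scope R_scope.

(** Let B be the primitive of [b] vanishing at [t0], let [damping] be e^{-B}
    and let [force] be the integral of |k| e^B.  Since (u' e^B)' = - k u e^B, a
    bound |u| <= M up to time s gives
    |u'(s)| <= [damping] s * (|u'(t0)| + M * [force] s)
    ([velocity_bound]), and hence, with P and Q the integrals of [damping] and
    of [damping] * [force],
    |u(t)| <= |u(t0)| + |u'(t0)| P(t) + M Q(t)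
    ([displacement_bound]).  P is bounded by the value J of the improper
    integral of [damping], and Q by 1/2.  Taking for M the maximum of |u| on a
    compact interval, the term M/2 is absorbed on the left and
    |u(t)| <= 2 (|u(t0)| + J |u'(t0)|)
    ([displacement_bound_initial]); this bound does not depend on the interval.
    The pointwise bounds 2 and 1/2 on [damping] and [damping] * [force] then
    control u' through [velocity_bound].  Both bounds are linear in the initial
    data, which is stability.

    Integrals of u and u' are avoided: increments are compared by the mean value
    theorem ([increment_le_of_derive_le]).  To have two-sided derivatives and
    continuous integrands at the endpoint [t0], the coefficients are extended to
    the left of [t0] by constants and solutions by affine functions. *)

(** * Passing from the half-line to the whole line *)

Definition affine_extension (t0 : R) (f : R -> R) (slope : R) : R -> R :=
  fun x => if Rle_dec t0 x then f x else f t0 + slope * (x - t0).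

Lemma affine_extension_eq (t0 : R) (f : R -> R) (slope x : R) :
  t0 <= x -> affine_extension t0 f slope x = f x.
Proof.
  intros hx; unfold affine_extension.
  destruct (Rle_dec t0 x); [reflexivity | contradiction].
Qed.

(** Continuing [f] along its right-hand tangent at [t0] turns the one-sided
    derivative there into a genuine one, so that the usual calculus applies on
    the closed half-line. *)
Lemma is_derive_affine_extension (t0 : R) (f g : R -> R) :
  derivative_on (half_line t0) f g ->
  forall t, t0 <= t -> is_derive (affine_extension t0 f (g t0)) t (g t).
Proof.
  intros hfg t ht.
  apply is_derive_Reals; intros eps heps.
  destruct (proj1 (filterlim_locally _ _) (hfg t ht) (mkposreal eps heps))
    as [d hd].
  (* Away from [t0] the increment is kept so small that [t + h] stays in the
     half-line; at [t0] negative increments only see the affine part. *)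
  assert (hd' : exists d' : posreal, d' <= d /\ (t = t0 \/ d' <= t - t0)).
  { destruct (Req_dec t t0) as [-> | hne].
    - exists d; split; [lra | now left].
    - assert (hpos : 0 < Rmin d (t - t0)).
      { apply Rmin_glb_lt; [apply cond_pos | lra]. }
      exists (mkposreal _ hpos); simpl.
      split; [apply Rmin_l | right; apply Rmin_r]. }
  destruct hd' as [d' [hdd' hcase]].
  exists d'; intros h hh0 hh.
  rewrite (affine_extension_eq t0 f _ t ht).
  unfold affine_extension; destruct (Rle_dec t0 (t + h)) as [hth | hth].
  - assert (hball : ball t d (t + h)).
    { change (Rabs (t + h - t) < d).
      replace (t + h - t) with h by ring; lra. }
    assert (hne : t + h <> t) by lra.
    generalize (hd (t + h) hball (conj hth hne)).
    change (Rabs ((f (t + h) - f t) / (t + h - t) - g t) < eps ->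
            Rabs ((f (t + h) - f t) / h - g t) < eps).
    now replace (t + h - t) with h by ring.
  - destruct hcase as [-> | hcase].
    + replace ((f t0 + g t0 * (t0 + h - t0) - f t0) / h - g t0) with 0
        by (field; lra).
      now rewrite Rabs_R0.
    + generalize (Rabs_def2 _ _ hh); lra.
Qed.

Lemma continuous_clamp (t0 : R) (f : R -> R) :
  continuous_on (half_line t0) f ->
  forall x, continuous (fun y => f (Rmax t0 y)) x.
Proof.
  intros hf x.
  apply filterlim_locally; intros eps.
  destruct (proj1 (filterlim_locally _ _) (hf (Rmax t0 x) (Rmax_l _ _)) eps)
    as [d hd].
  exists d; intros y hy.
  apply hd; [ | apply Rmax_l].
  change (Rabs (y - x) < d) in hy.
  change (Rabs (Rmax t0 y - Rmax t0 x) < d).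
  revert hy; unfold Rmax.
  destruct (Rle_dec t0 y), (Rle_dec t0 x); unfold Rabs;
    repeat destruct Rcase_abs; intros; lra.
Qed.

(** * Calculus lemmas *)

Lemma is_derive_continuity_pt (f : R -> R) (x l : R) :
  is_derive f x l -> continuity_pt f x.
Proof.
  intros hf; apply derivable_continuous_pt.
  exists l; now apply is_derive_Reals.
Qed.

Lemma nondecreasing_of_derive_nonneg (f df : R -> R) (x y : R) :
  x <= y ->
  (forall z, x <= z <= y -> is_derive f z (df z)) ->
  (forall z, x <= z <= y -> 0 <= df z) ->
  f x <= f y.
Proof.
  intros hxy hf hpos.
  destruct (MVT_gen f x y df) as [c [hc heq]].
  - rewrite Rmin_left, Rmax_right by lra; intros z hz; apply hf; lra.
  - rewrite Rmin_left, Rmax_right by lra; intros z hz.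
    apply (is_derive_continuity_pt f z (df z)), hf; lra.
  - rewrite Rmin_left, Rmax_right in hc by lra.
    assert (hlen : 0 <= y - x) by lra.
    generalize (Rmult_le_pos _ _ (hpos c hc) hlen); lra.
Qed.

(** Both [g - f] and [g + f] are nondecreasing.  Estimating increments this way
    replaces the integration of [df], whose integrability is not assumed. *)
Lemma increment_le_of_derive_le (f df g dg : R -> R) (x y : R) :
  x <= y ->
  (forall z, x <= z <= y -> is_derive f z (df z)) ->
  (forall z, x <= z <= y -> is_derive g z (dg z)) ->
  (forall z, x <= z <= y -> Rabs (df z) <= dg z) ->
  Rabs (f y - f x) <= g y - g x.
Proof.
  intros hxy hf hg hle.
  assert (h1 : g x - f x <= g y - f y).
  { apply (nondecreasing_of_derive_nonneg
             (fun z => g z - f z) (fun z => dg z - df z)); [exact hxy | | ].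
    - intros z hz; exact (is_derive_minus g f z _ _ (hg z hz) (hf z hz)).
    - intros z hz; generalize (hle z hz) (Rle_abs (df z)); lra. }
  assert (h2 : g x + f x <= g y + f y).
  { apply (nondecreasing_of_derive_nonneg
             (fun z => g z + f z) (fun z => dg z + df z)); [exact hxy | | ].
    - intros z hz; exact (is_derive_plus g f z _ _ (hg z hz) (hf z hz)).
    - intros z hz; generalize (hle z hz) (Rabs_maj2 (df z)); lra. }
  apply Rabs_le; lra.
Qed.

Lemma ex_RInt_of_continuous (f : R -> R) (x y : R) :
  (forall z, continuous f z) -> ex_RInt f x y.
Proof. intros hf; apply (ex_RInt_continuous f); intros z _; apply hf. Qed.

Lemma is_derive_primitive (f : R -> R) (a x : R) :
  (forall z, continuous f z) -> is_derive (RInt f a) x (f x).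
Proof.
  intros hf; apply (is_derive_RInt f (RInt f a) a x); [ | apply hf].
  apply filter_forall; intros y.
  now apply (RInt_correct f), ex_RInt_of_continuous.
Qed.

Lemma continuous_of_is_derive (f df : R -> R) :
  (forall x, is_derive f x (df x)) -> forall x, continuous f x.
Proof. intros hf x; apply (ex_derive_continuous f); exists (df x); apply hf. Qed.

(** The improper integral only sees [f] on the half-line, while continuity is
    asked of the extension [g]; beyond [t] the integral of [g] can only grow. *)
Lemma RInt_le_improper (f g : R -> R) (a l t : R) :
  (forall x, continuous g x) ->
  (forall x, a <= x -> f x = g x) ->
  (forall x, a <= x -> 0 <= g x) ->
  is_RInt_gen f (at_point a) (Rbar_locally p_infty) l ->
  a <= t -> RInt g a t <= l.
Proof.
  intros hg hfg hpos hl hat.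
  apply Rnot_lt_le; intros hlt.
  assert (heps : 0 < RInt g a t - l) by lra.
  destruct (proj1 (filterlimi_locally _ _) hl (mkposreal _ heps))
    as [A N hA [M hM] hAN].
  (* [M] bounds the times excluded by the filter at infinity, strictly. *)
  set (T := Rmax t (M + 1)).
  assert (hTt : t <= T) by apply Rmax_l.
  assert (hTM : M < T) by (generalize (Rmax_r t (M + 1)); unfold T; lra).
  destruct (hAN a T hA (hM T hTM)) as [y [hy hyl]]; simpl in hy.
  change (Rabs (y - l) < RInt g a t - l) in hyl.
  assert (hy' : RInt g a T = y).
  { apply is_RInt_unique; apply (is_RInt_ext f g); [ | exact hy].
    rewrite Rmin_left by lra; intros x hx; apply hfg; lra. }
  assert (hch : RInt g a t + RInt g t T = RInt g a T).
  { apply (RInt_Chasles g); now apply ex_RInt_of_continuous. }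
  assert (htail : 0 <= RInt g t T).
  { apply RInt_ge_0; [lra | now apply ex_RInt_of_continuous | ].
    intros x hx; apply hpos; lra. }
  generalize (Rle_abs (y - l)); lra.
Qed.

(** * The damping factor and the accumulated restoring force *)

Definition damping (b : R -> R) (t0 s : R) : R := exp (- RInt b t0 s).

Definition force (b k : R -> R) (t0 s : R) : R :=
  RInt (fun tau => Rabs (k tau) * exp (RInt b t0 tau)) t0 s.

Lemma damping_ext (b b' : R -> R) (t0 s : R) :
  (forall x, t0 <= x -> b x = b' x) -> t0 <= s ->
  damping b t0 s = damping b' t0 s.
Proof.
  intros hbb' hs; unfold damping; do 2 f_equal; apply RInt_ext.
  rewrite Rmin_left by lra; intros x hx; apply hbb'; lra.
Qed.

Lemma force_ext (b b' k k' : R -> R) (t0 s : R) :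
  (forall x, t0 <= x -> b x = b' x) ->
  (forall x, t0 <= x -> k x = k' x) -> t0 <= s ->
  force b k t0 s = force b' k' t0 s.
Proof.
  intros hbb' hkk' hs; unfold force; apply RInt_ext.
  rewrite Rmin_left by lra; intros x hx; rewrite (hkk' x) by lra.
  do 2 f_equal; apply RInt_ext.
  rewrite Rmin_left by lra; intros y hy; apply hbb'; lra.
Qed.

Lemma is_derive_exp_primitive (b : R -> R) (t0 x : R) :
  (forall z, continuous b z) ->
  is_derive (fun s => exp (RInt b t0 s)) x (b x * exp (RInt b t0 x)).
Proof.
  intros hb; apply (is_derive_comp exp (RInt b t0)).
  - apply is_derive_exp.
  - now apply is_derive_primitive.
Qed.

Lemma continuous_damping (b : R -> R) (t0 x : R) :
  (forall z, continuous b z) -> continuous (damping b t0) x.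
Proof.
  intros hb.
  apply (continuous_comp (fun s => - RInt b t0 s) exp).
  - apply (continuous_opp (RInt b t0)).
    apply (continuous_of_is_derive (RInt b t0) b).
    intros y; now apply is_derive_primitive.
  - apply (continuous_of_is_derive exp exp), is_derive_exp.
Qed.

Lemma continuous_force_density (b k : R -> R) (t0 x : R) :
  (forall z, continuous b z) -> (forall z, continuous k z) ->
  continuous (fun tau => Rabs (k tau) * exp (RInt b t0 tau)) x.
Proof.
  intros hb hk.
  apply (continuous_mult (fun tau => Rabs (k tau))
           (fun tau => exp (RInt b t0 tau))).
  - apply (continuous_comp k Rabs); [apply hk | apply continuous_Rabs].
  - apply (continuous_of_is_derive _ (fun s => b s * exp (RInt b t0 s))).
    intros y; now apply is_derive_exp_primitive.
Qed.

Lemma is_derive_force (b k : R -> R) (t0 x : R) :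
  (forall z, continuous b z) -> (forall z, continuous k z) ->
  is_derive (force b k t0) x (Rabs (k x) * exp (RInt b t0 x)).
Proof.
  intros hb hk.
  apply (is_derive_primitive
           (fun tau => Rabs (k tau) * exp (RInt b t0 tau)) t0 x).
  intros z; now apply continuous_force_density.
Qed.

Lemma continuous_damped_force (b k : R -> R) (t0 x : R) :
  (forall z, continuous b z) -> (forall z, continuous k z) ->
  continuous (fun s => damping b t0 s * force b k t0 s) x.
Proof.
  intros hb hk.
  apply (continuous_mult (damping b t0) (force b k t0)).
  - now apply continuous_damping.
  - apply (continuous_of_is_derive _
             (fun s => Rabs (k s) * exp (RInt b t0 s))).
    intros y; now apply is_derive_force.
Qed.

Lemma force_nonneg (b k : R -> R) (t0 s : R) :
  (forall z, continuous b z) -> (forall z, continuous k z) ->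
  t0 <= s -> 0 <= force b k t0 s.
Proof.
  intros hb hk hs; apply RInt_ge_0; [exact hs | | ].
  - apply ex_RInt_of_continuous; intros z; now apply continuous_force_density.
  - intros x _; apply Rmult_le_pos; [apply Rabs_pos | left; apply exp_pos].
Qed.

(** * A priori bounds *)

(** With the integrating factor, (v e^B)' = - k u e^B where B is the primitive
    of [b]; this is at most M |k| e^B, the derivative of M times [force]. *)
Lemma velocity_bound (t0 s M : R) (b k u v : R -> R) :
  (forall x, continuous b x) -> (forall x, continuous k x) ->
  (forall x, t0 <= x -> is_derive v x (- b x * v x - k x * u x)) ->
  t0 <= s -> (forall x, t0 <= x <= s -> Rabs (u x) <= M) ->
  Rabs (v s) <= damping b t0 s * (Rabs (v t0) + M * force b k t0 s).
Proof.
  intros hb hk hv hs hM.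
  set (e := fun x => exp (RInt b t0 x)).
  assert (he : forall x, 0 < e x) by (intros x; apply exp_pos).
  assert (hincr : Rabs (v s * e s - v t0 * e t0)
                  <= M * force b k t0 s - M * force b k t0 t0).
  { apply (increment_le_of_derive_le
             (fun x => v x * e x) (fun x => - (k x * u x * e x))
             (fun x => M * force b k t0 x)
             (fun x => M * (Rabs (k x) * e x))); [exact hs | | | ].
    - intros x hx.
      replace (- (k x * u x * e x))
        with ((- b x * v x - k x * u x) * e x + v x * (b x * e x)) by ring.
      apply (is_derive_mult v e);
        [apply hv; lra | now apply is_derive_exp_primitive | exact Rmult_comm].
    - intros x hx.
      apply (is_derive_scal (force b k t0) x M); now apply is_derive_force.
    - intros x hx.
      rewrite Rabs_Ropp, !Rabs_mult, (Rabs_pos_eq (e x)) by (left; apply he).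
      replace (M * (Rabs (k x) * e x)) with (Rabs (k x) * M * e x) by ring.
      apply Rmult_le_compat_r; [left; apply he | ].
      apply Rmult_le_compat_l; [apply Rabs_pos | apply hM; exact hx]. }
  assert (he0 : e t0 = 1) by (unfold e; rewrite RInt_point; apply exp_0).
  assert (hf0 : force b k t0 t0 = 0) by (unfold force; now rewrite RInt_point).
  rewrite he0, hf0, Rmult_1_r, Rmult_0_r, Rminus_0_r in hincr.
  assert (hve : Rabs (v s) * e s <= Rabs (v t0) + M * force b k t0 s).
  { rewrite <- (Rabs_pos_eq (e s)) at 1 by (left; apply he).
    rewrite <- Rabs_mult.
    generalize (Rabs_triang_inv (v s * e s) (v t0)); lra. }
  unfold damping; rewrite exp_Ropp; fold (e s).
  apply (Rmult_le_reg_r (e s)); [apply he | ].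
  replace (/ e s * (Rabs (v t0) + M * force b k t0 s) * e s)
    with (Rabs (v t0) + M * force b k t0 s)
    by (field; apply Rgt_not_eq, he).
  exact hve.
Qed.

Lemma displacement_bound (t0 t M : R) (b k u v : R -> R) :
  (forall x, continuous b x) -> (forall x, continuous k x) ->
  (forall x, t0 <= x -> is_derive u x (v x)) ->
  (forall x, t0 <= x -> is_derive v x (- b x * v x - k x * u x)) ->
  t0 <= t -> (forall x, t0 <= x <= t -> Rabs (u x) <= M) ->
  Rabs (u t) <= Rabs (u t0) + Rabs (v t0) * RInt (damping b t0) t0 t
                + M * RInt (fun s => damping b t0 s * force b k t0 s) t0 t.
Proof.
  intros hb hk hu hv ht hM.
  set (P := RInt (damping b t0) t0).
  set (Q := RInt (fun s => damping b t0 s * force b k t0 s) t0).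
  assert (hincr : Rabs (u t - u t0)
            <= (Rabs (v t0) * P t + M * Q t) - (Rabs (v t0) * P t0 + M * Q t0)).
  { apply (increment_le_of_derive_le u v
             (fun x => Rabs (v t0) * P x + M * Q x)
             (fun x => Rabs (v t0) * damping b t0 x
                       + M * (damping b t0 x * force b k t0 x)));
      [exact ht | intros x hx; apply hu; lra | | ].
    - intros x hx.
      apply (is_derive_plus (fun y => Rabs (v t0) * P y) (fun y => M * Q y)).
      + apply (is_derive_scal P); apply is_derive_primitive.
        intros z; now apply continuous_damping.
      + apply (is_derive_scal Q).
        apply (is_derive_primitive
                 (fun s => damping b t0 s * force b k t0 s)).
        intros z; now apply continuous_damped_force.
    - intros x hx.
      replace (Rabs (v t0) * damping b t0 x
               + M * (damping b t0 x * force b k t0 x))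
        with (damping b t0 x * (Rabs (v t0) + M * force b k t0 x)) by ring.
      apply (velocity_bound t0 x M b k u v hb hk hv); [lra | ].
      intros y hy; apply hM; lra. }
  assert (hP0 : P t0 = 0) by (unfold P; now rewrite RInt_point).
  assert (hQ0 : Q t0 = 0) by (unfold Q; now rewrite RInt_point).
  rewrite hP0, hQ0 in hincr.
  generalize (Rabs_triang_inv (u t) (u t0)); lra.
Qed.

(** Applying [displacement_bound] at a point where |u| is maximal on the interval from [t0] to [t]
    gives M <= |u t0| + J |v t0| + M/2, and the last term is absorbed. *)
Lemma displacement_bound_initial (t0 t J : R) (b k u v : R -> R) :
  (forall x, continuous b x) -> (forall x, continuous k x) ->
  (forall x, t0 <= x -> is_derive u x (v x)) ->
  (forall x, t0 <= x -> is_derive v x (- b x * v x - k x * u x)) ->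
  (forall s, t0 <= s -> RInt (damping b t0) t0 s <= J) ->
  (forall s, t0 <= s ->
     RInt (fun r => damping b t0 r * force b k t0 r) t0 s <= 1 / 2) ->
  t0 <= t -> Rabs (u t) <= 2 * (Rabs (u t0) + J * Rabs (v t0)).
Proof.
  intros hb hk hu hv hJ hQ ht.
  destruct (continuity_ab_maj (fun x => Rabs (u x)) t0 t ht)
    as [m [hmax hm]].
  { intros c hc.
    apply (continuity_pt_comp u Rabs); [ | apply Rcontinuity_abs].
    apply (is_derive_continuity_pt u c (v c)), hu; lra. }
  assert (hbound : Rabs (u m) <= Rabs (u t0)
            + Rabs (v t0) * RInt (damping b t0) t0 m
            + Rabs (u m)
              * RInt (fun s => damping b t0 s * force b k t0 s) t0 m).
  { apply displacement_bound; try assumption; [lra | ].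
    intros x hx; apply hmax; lra. }
  assert (h1 : Rabs (v t0) * RInt (damping b t0) t0 m <= Rabs (v t0) * J).
  { apply Rmult_le_compat_l; [apply Rabs_pos | apply hJ; lra]. }
  assert (h2 : Rabs (u m)
                 * RInt (fun s => damping b t0 s * force b k t0 s) t0 m
               <= Rabs (u m) * (1 / 2)).
  { apply Rmult_le_compat_l; [apply Rabs_pos | apply hQ; lra]. }
  generalize (hmax t (conj ht (Rle_refl t))); lra.
Qed.

(** * Stability *)

Lemma Rabs_lt_of_sum_sq_lt (x y d : R) :
  0 < d -> x ^ 2 + y ^ 2 < d ^ 2 -> Rabs x < d /\ Rabs y < d.
Proof.
  intros hd h.
  generalize (pow2_ge_0 x) (pow2_ge_0 y); intros hx hy.
  split; rewrite <- (Rabs_pos_eq d) by lra; apply Rsqr_lt_abs_0;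
    unfold Rsqr; lra.
Qed.

Lemma sq_le_of_Rabs_le (x c : R) : Rabs x <= c -> x ^ 2 <= c ^ 2.
Proof.
  intros h; rewrite <- (pow2_abs x).
  apply pow_incr; split; [apply Rabs_pos | exact h].
Qed.

Theorem theorem3p4 (t0 : R) (b k : R -> R)
  (hb : continuous_on (half_line t0) b)
  (hk : continuous_on (half_line t0) k)
  (hint : ex_RInt_gen (fun s => exp (- RInt b t0 s))
            (at_point t0) (Rbar_locally p_infty))
  (hlt2 : forall s, t0 <= s -> exp (- RInt b t0 s) < 2)
  (hintk : improper_integral_lt
             (fun s => exp (- RInt b t0 s) *
                RInt (fun tau => Rabs (k tau) * exp (RInt b t0 tau)) t0 s)
             t0 (1 / 2))
  (hltk : forall s, t0 <= s ->
            exp (- RInt b t0 s) *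
              RInt (fun tau => Rabs (k tau) * exp (RInt b t0 tau)) t0 s
            < 1 / 2) :
  zero_solution_stable t0 b k.
Proof.
  destruct hintk as [hexk hvalk].
  set (b' := fun x => b (Rmax t0 x)).
  set (k' := fun x => k (Rmax t0 x)).
  assert (hb' : forall x, continuous b' x) by now apply continuous_clamp.
  assert (hk' : forall x, continuous k' x) by now apply continuous_clamp.
  assert (hbb' : forall x, t0 <= x -> b x = b' x)
    by (intros x hx; unfold b'; now rewrite Rmax_right).
  assert (hkk' : forall x, t0 <= x -> k x = k' x)
    by (intros x hx; unfold k'; now rewrite Rmax_right).
  assert (hE : forall s, t0 <= s -> damping b t0 s = damping b' t0 s)
    by (intros s hs; now apply damping_ext).
  assert (hEG : forall s, t0 <= s ->
      damping b t0 s * force b k t0 s = damping b' t0 s * force b' k' t0 s).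
  { intros s hs; rewrite (hE s hs); f_equal; now apply force_ext. }
  assert (hEpos : forall s, 0 < damping b' t0 s) by (intros; apply exp_pos).
  destruct hint as [J hJ].
  assert (hP : forall s, t0 <= s -> RInt (damping b' t0) t0 s <= J).
  { intros s hs.
    apply (RInt_le_improper (damping b t0)); try assumption.
    - intros x; now apply continuous_damping.
    - intros x _; left; apply hEpos. }
  assert (hQ : forall s, t0 <= s ->
      RInt (fun r => damping b' t0 r * force b' k' t0 r) t0 s <= 1 / 2).
  { intros s hs; apply Rle_trans with (2 := Rlt_le _ _ hvalk).
    apply (RInt_le_improper (fun r => damping b t0 r * force b k t0 r));
      try assumption.
    - intros x; now apply continuous_damped_force.
    - intros x hx; apply Rmult_le_pos;
        [left; apply hEpos | now apply force_nonneg].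
    - now apply (RInt_gen_correct
                   (fun r => damping b t0 r * force b k t0 r)). }
  assert (hJ0 : 0 <= J).
  { generalize (hP t0 (Rle_refl t0)); rewrite RInt_point.
    now unfold zero; simpl. }
  intros eps heps.
  (* A solution starting within d satisfies |u| <= 2 (1 + J) d and
     |u'| <= 2 d + (1 + J) d, so |u| + |u'| <= (5 + 3 J) d. *)
  set (d := eps / (5 + 3 * J)).
  assert (hd : 0 < d) by (apply Rdiv_lt_0_compat; lra).
  exists d; split; [exact hd | ].
  intros u du [hu [ddu [hdu heq]]] hinit t ht.
  destruct (Rabs_lt_of_sum_sq_lt _ _ _ hd hinit) as [hu0 hv0].
  set (U := affine_extension t0 u (du t0)).
  set (V := affine_extension t0 du (ddu t0)).
  assert (hUu : forall x, t0 <= x -> U x = u x)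
    by (intros x hx; now apply affine_extension_eq).
  assert (hVv : forall x, t0 <= x -> V x = du x)
    by (intros x hx; now apply affine_extension_eq).
  assert (hU : forall x, t0 <= x -> is_derive U x (V x)).
  { intros x hx; rewrite (hVv x hx); now apply is_derive_affine_extension. }
  assert (hV : forall x, t0 <= x ->
                 is_derive V x (- b' x * V x - k' x * U x)).
  { intros x hx; rewrite (hVv x hx), (hUu x hx), <- (hbb' x hx), <- (hkk' x hx).
    replace (- b x * du x - k x * u x) with (ddu x)
      by (generalize (heq x hx); lra).
    now apply is_derive_affine_extension. }
  set (M := 2 * (Rabs (u t0) + J * Rabs (du t0))).
  assert (hUM : forall x, t0 <= x -> Rabs (U x) <= M).
  { intros x hx; unfold M.
    rewrite <- (hUu t0), <- (hVv t0) by lra.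
    now apply (displacement_bound_initial t0 x J b' k' U V). }
  assert (hVt : Rabs (du t) <= 2 * Rabs (du t0) + M * (1 / 2)).
  { rewrite <- (hVv t ht), <- (hVv t0) by lra.
    apply Rle_trans
      with (1 := velocity_bound t0 t M b' k' U V hb' hk' hV ht
                   (fun x hx => hUM x (proj1 hx))).
    rewrite Rmult_plus_distr_l.
    apply Rplus_le_compat.
    - apply Rmult_le_compat_r; [apply Rabs_pos | ].
      rewrite <- (hE t ht); left; now apply hlt2.
    - replace (damping b' t0 t * (M * force b' k' t0 t))
        with (M * (damping b' t0 t * force b' k' t0 t)) by ring.
      apply Rmult_le_compat_l.
      + apply Rle_trans with (2 := hUM t ht), Rabs_pos.
      + rewrite <- (hEG t ht); left; now apply hltk. }
  assert (hJd : J * Rabs (du t0) <= J * d)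
    by (apply Rmult_le_compat_l; lra).
  assert (hut : Rabs (u t) <= 2 * (1 + J) * d).
  { rewrite <- (hUu t ht).
    apply Rle_trans with (1 := hUM t ht); unfold M; lra. }
  assert (hdut : Rabs (du t) <= (3 + J) * d) by (unfold M in hVt; lra).
  apply sq_le_of_Rabs_le in hut; apply sq_le_of_Rabs_le in hdut.
  replace eps with ((5 + 3 * J) * d) by (unfold d; field; lra).
  (* The cross term of the square makes the final inequality strict. *)
  assert (hcross : 0 < (2 * (1 + J) * d) * ((3 + J) * d)).
  { apply Rmult_lt_0_compat; apply Rmult_lt_0_compat; lra. }
  lra.
Qed.
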